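(* Let $\mathcal{H}$ be a complex Hilbert space, $T\in\mathcal{B}(\mathcal{H})$, and let $$\mathcal{H}_0=\{x\in\mathcal{H}: \|(T^*T+TT^* )x\|=\|T^*T+TT^*\|\,\|x\|\}.$$ Suppose $\mathcal{H}_0\ne\{0\}$ and let $T_0=T|_{\mathcal{H}_0}$ be the restriction of $T$ to $\mathcal{H}_0$. Then $$w^2(T)\ge \sup_{\alpha,\beta}\left\{\frac{\alpha}{\alpha+\beta}\sup_{x\in\mathcal{H}_0,\,\|x\|=1}|\langle T_0x,x\rangle|^2+\frac{\beta}{4(\alpha+\beta)}\|T^*T+TT^*\|\right\}\ge \frac14\|T^*T+TT^*\|,$$ where the outer supremum is over all real $\alpha,\beta\ge0$ with $(\alpha,\beta)\neq(0,0)$.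
   Context: $\mathcal{B}(\mathcal{H})$ is the $C^*$-algebra of bounded linear operators on $\mathcal{H}$. $w(T)=\sup\{|\langle Tx,x\rangle|: x\in\mathcal{H},\|x\|=1\}$ is the numerical radius, $\|T\|$ the operator norm. $T_0$ is regarded as a map $\mathcal{H}_0\to\mathcal{H}$; $\mathcal{H}_0$ need not be invariant under $T$. *)

(* Defs.v *)
From HB Require Import structures.
From mathcomp Require Import all_boot all_order all_algebra.
From mathcomp Require Import sesquilinear.
From mathcomp Require Export complex.
From mathcomp Require Import boolp classical_sets functions reals.
From mathcomp Require Import topology normedtype.

Set Implicit Arguments.
Unset Strict Implicit.
Unset Printing Implicit Defensive.

Import Order.TTheory GRing.Theory Num.Theory.
Import numFieldNormedType.Exports.

Local Open Scope classical_set_scope.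
Local Open Scope ring_scope.
Local Open Scope complex_scope.

(* Complex Hilbert spaces: Banach spaces over [R[i]] whose norm is induced by
   an inner product.  As everywhere with [{dot _ for _}], the inner product is
   linear in its first argument and conjugate-linear in the second. *)
HB.mixin Record CompleteNormedModule_isHilbert (R : realType) V
    of CompleteNormedModule R[i] V := {
  inner : {dot V for (@Num.conj R[i])};
  normr_inner : forall x : V, `|x| ^+ 2 = inner x x
}.

#[short(type="hilbertType")]
HB.structure Definition Hilbert (R : realType) :=
  {V of CompleteNormedModule_isHilbert R V & CompleteNormedModule R[i] V}.

Notation "''[' x , y ]" := (inner x y) : ring_scope.

(* The norms of vectors and of complex scalars are elements of [R[i]] that
   happen to be nonnegative reals (see [rnormE]); suprema are taken in [R]. *)
Definition rnorm (R : realType) (V : normedZmodType R[i]) (x : V) : R :=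
  complex.Re `|x|.

Lemma rnormE (R : realType) (V : normedZmodType R[i]) (x : V) :
  (rnorm x)%:C = `|x|.
Proof. by rewrite /rnorm RRe_real // normr_real. Qed.

Section Operators.
Variables (R : realType) (H : hilbertType R).
Implicit Types T A : H -> H.

Definition bounded_operator (T : {linear H -> H}) : Prop :=
  exists M : R, forall x, rnorm (T x) <= M * rnorm x.

(* [adjoint T y] is the vector [z] such that [<T x, y> = <x, z>] for all [x];
   it exists and is unique for bounded linear [T] by the Riesz representation
   theorem.  The default value 0 is only used for other [T]. *)
Definition adjoint T : H -> H :=
  fun y => xget 0 [set z | forall x, '[T x, y] = '[x, z]].

Definition opnorm A : R :=
  sup [set rnorm (A x) | x in [set x | rnorm x <= 1]].

Definition numerical_radius T : R :=
  sup [set rnorm '[T x, x] | x in [set x | rnorm x = 1]].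

(* T^* T + T T^* *)
Definition anticomm_adjoint T : H -> H :=
  (adjoint T \o T) \+ (T \o adjoint T).

Definition norm_attaining T : set H :=
  [set x | rnorm (anticomm_adjoint T x) =
           opnorm (anticomm_adjoint T) * rnorm x].

End Operators.

(* Main.v *)
(* With w the numerical radius, polarization gives
   |<Tu,v>| + |<Tv,u>| <= 2 w |u| |v|, so each of Tu + T'u, Tu - T'u has norm
   at most 2 w |u|, where T' is the adjoint.  With p = Tx + T'x, q = Tx - T'x,
     2 <(T'T + TT')x, v> = (<Tp,v> + <p,Tv>) - (<Tq,v> - <q,Tv>),
   whence |T'T + TT'| <= 4 w^2.  The supremum over (alpha, beta) is that of the
   convex combinations of two numbers, both at most w^2. *)
Require Import Defs.
From mathcomp Require Import all_boot all_order all_algebra.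
From mathcomp Require Import sesquilinear.
From mathcomp Require Import boolp classical_sets functions reals.
From mathcomp Require Import topology normedtype.
From mathcomp Require Import ring.

Import Order.TTheory GRing.Theory Num.Theory.

Local Open Scope classical_set_scope.
Local Open Scope ring_scope.

(** * Unimodular phases of complex numbers *)

Lemma exists_phase (C : numClosedFieldType) (x : C) :
  exists2 c : C, `|c| = 1 & c * x = `|x|.
Proof.
have [->|x0] := eqVneq x 0; first by exists 1; rewrite ?normr1 ?mulr0 ?normr0.
exists (x^* / `|x|).
  by rewrite normf_div norm_conjC normr_id divff ?normr_eq0.
by rewrite mulrAC [_ * x]mulrC -normCK expr2 mulfK ?normr_eq0.
Qed.

Lemma exists_aligning_phase (C : numClosedFieldType) (x y : C) :
  exists2 c : C, `|c| = 1 & `|c^* * x + c * y| = `|x| + `|y|.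
Proof.
have [p p1 px] := exists_phase C x; have [q q1 qy] := exists_phase C y.
(* The square root makes [c^* * x] and [c * y] share the phase [c^* * p^*]: since [c * c = q * p^*],
   one has [c^* * p^* * q = c]. *)
pose c := sqrtC (q * p^*).
have c1 : `|c| = 1.
  apply/eqP; rewrite -sqrp_eq1 // -normrX sqrtCK.
  by rewrite normrM norm_conjC p1 q1 mulr1.
exists c => //.
have cc : c^* * c = 1 by rewrite mulrC -normCK c1 expr1n.
have pp : p^* * p = 1 by rewrite mulrC -normCK p1 expr1n.
have c2 : c * c = q * p^* by rewrite -expr2 sqrtCK.
have -> : c^* * x + c * y = c^* * p^* * (p * x + q * y).
  transitivity (c^* * x + c^* * c * c * y); first by rewrite cc mul1r.
  transitivity (p^* * p * c^* * x + c^* * (c * c) * y); first by rewrite pp; ring.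
  by rewrite c2; ring.
rewrite px qy !normrM !norm_conjC c1 p1 !mul1r ger0_norm //.
by rewrite addr_ge0.
Qed.

(** * Cauchy-Schwarz and the parallelogram law *)

Section InnerProduct.
Variables (R : realType) (H : hilbertType R).
Implicit Types (u v : H) (c : R[i]).

Lemma innerDl u1 u2 v : '[u1 + u2, v] = '[u1, v] + '[u2, v].
Proof. exact: linearDl. Qed.
Lemma innerDr u v1 v2 : '[u, v1 + v2] = '[u, v1] + '[u, v2].
Proof. exact: linearDr. Qed.
Lemma innerNl u v : '[- u, v] = - '[u, v].
Proof. exact: linearNl. Qed.
Lemma innerNr u v : '[u, - v] = - '[u, v].
Proof. exact: linearNr. Qed.
Lemma innerZl c u v : '[c *: u, v] = c * '[u, v].
Proof. exact: linearZl_LR. Qed.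
Lemma innerZr c u v : '[u, c *: v] = c^* * '[u, v].
Proof. exact: linearZr_LR. Qed.
Lemma inner_conj u v : '[u, v] = ('[v, u])^*.
Proof. by rewrite hermC expr0 mul1r. Qed.

(** Cauchy-Schwarz follows from the triangle inequality: once [c] rotates the inner product to its
    modulus, squaring the inequality for [c *: u + v] leaves only the cross terms. *)
Lemma normr_inner_le u v : `|'[u, v]| <= `|u| * `|v|.
Proof.
have [c c1 cx] := exists_phase _ '[u, v].
have h : `|c *: u + v| ^+ 2 <= (`|u| + `|v|) ^+ 2.
  rewrite ler_sqr ?nnegrE ?addr_ge0 //.
  by apply: (le_trans (ler_normD _ _)); rewrite normrZ c1 mul1r.
move: h; rewrite normr_inner innerDl !innerDr (inner_conj v).
rewrite -!normr_inner normrZ c1 mul1r innerZl cx.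
rewrite (CrealP _) ?normr_real // sqrrD => h.
rewrite -(ler_pMn2r (n := 2)) //.
rewrite mulr2n -subr_ge0; rewrite -subr_ge0 in h.
by congr (is_true (0 <= _)): h; ring.
Qed.

Lemma parallelogram u v :
  `|u + v| ^+ 2 + `|u - v| ^+ 2 = 2 * (`|u| ^+ 2 + `|v| ^+ 2).
Proof.
rewrite !normr_inner !(innerDl, innerDr, innerNl, innerNr); ring.
Qed.

End InnerProduct.

(** * Norm bounds from a bound on the quadratic form *)

Section NumericalRadiusBound.
Variables (R : realType) (H : hilbertType R) (T : {linear H -> H}) (w : R[i]).
Hypothesis hw : forall u : H, `|'[T u, u]| <= w * `|u| ^+ 2.
Implicit Types (u v x y : H).

Lemma polarization_bound u v :
  `|'[T u, v] + '[T v, u]| <= w * (`|u| ^+ 2 + `|v| ^+ 2).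
Proof.
rewrite -(ler_pM2l (x := 2)) // -[X in X * `|_|](ger0_norm (x := 2)) // -normrM.
have -> : 2 * ('[T u, v] + '[T v, u]) =
    '[T (u + v), u + v] - '[T (u - v), u - v].
  rewrite (linearB T) (linearD T) !(innerDl, innerDr, innerNl, innerNr); ring.
apply: le_trans (ler_normB _ _) _.
apply: le_trans (lerD (hw _) (hw _)) _.
by rewrite -mulrDr parallelogram mulrCA.
Qed.

Lemma offdiag_bound u v :
  `|'[T u, v]| + `|'[T v, u]| <= 2 * w * `|u| * `|v|.
Proof.
have [->|u0] := eqVneq u 0.
  by rewrite (linear0 T) linear0l linear0r !normr0 !(mulr0, mul0r) addr0.
have [->|v0] := eqVneq v 0.
  by rewrite (linear0 T) linear0l linear0r !normr0 !(mulr0, mul0r) addr0.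
have [c c1 cE] := exists_aligning_phase _ '[T u, v] '[T v, u].
have pos : 0 < `|u| * `|v| by rewrite mulr_gt0 ?normr_gt0.
rewrite -(ler_pM2l pos).
(* Both rescaled vectors have norm [|u| * |v|], which turns the sum of squares into twice a squared
   product; [c] aligns the two terms so that their moduli add up. *)
have := polarization_bound (`|v| *: u) ((c * `|u|) *: v).
rewrite !(linearZ_LR T) /= !innerZl !innerZr !normrZ normrM c1 mul1r !normr_id.
rewrite rmorphM /= !(CrealP (normr_real _)).
have -> : `|v| * (c^* * `|u| * '[T u, v]) + c * `|u| * (`|v| * '[T v, u]) =
   (`|u| * `|v|) * (c^* * '[T u, v] + c * '[T v, u]) by ring.
rewrite normrM cE (ger0_norm (ltW pos)) => /le_trans; apply.
by rewrite le_eqVlt; apply/orP; left; apply/eqP; ring.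
Qed.

Lemma sym_bound u v :
  `|'[T u, v] + '[u, T v]| <= 2 * w * `|u| * `|v|.
Proof.
apply: le_trans (ler_normD _ _) _.
by rewrite (inner_conj _ _ u) norm_conjC offdiag_bound.
Qed.

Lemma skew_bound u v :
  `|'[T u, v] - '[u, T v]| <= 2 * w * `|u| * `|v|.
Proof.
apply: le_trans (ler_normB _ _) _.
by rewrite (inner_conj _ _ u) norm_conjC offdiag_bound.
Qed.

Lemma normr_le_of_inner x (b : R[i]) :
  0 <= b -> `|'[x, x]| <= b * `|x| -> `|x| <= b.
Proof.
move=> b0; rewrite -normr_inner normrX normr_id.
have [->|x0] := eqVneq x 0; first by rewrite normr0.
by rewrite expr2 ler_pM2r ?normr_gt0.
Qed.

Hypothesis w0 : 0 <= w.

Let bnd x : 0 <= 2 * w * `|x|.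
Proof. by rewrite !mulr_ge0. Qed.

Lemma normr_operator_le x : `|T x| <= 2 * w * `|x|.
Proof.
apply: normr_le_of_inner => //.
(* For the pair [x], [T x] the first term is the squared norm of [T x]; the other is nonnegative and
   is dropped. *)
by apply: le_trans (offdiag_bound x (T x)); rewrite lerDl.
Qed.

(* The second alternative never occurs (by the Riesz representation theorem),
   but the bounds below hold in that case too, so it need not be excluded. *)
Lemma adjointP y :
  (forall x, '[T x, y] = '[x, adjoint T y]) \/ adjoint T y = 0.
Proof. by rewrite /adjoint; case: xgetP => [z _ /= h|_]; [left|right]. Qed.

Lemma normr_adjoint_le y : `|adjoint T y| <= 2 * w * `|y|.
Proof.
have [h|->] := adjointP y; last by rewrite normr0.
apply: normr_le_of_inner => //; rewrite -h mulrAC.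
by apply: le_trans (offdiag_bound (adjoint T y) y); rewrite lerDl.
Qed.

Lemma normr_anticomm_adjoint_le x :
  `|anticomm_adjoint T x| <= 4 * w ^+ 2 * `|x|.
Proof.
(* Serves the cases where an adjoint takes its default value 0: one summand vanishes, and the other
   is a composition of two maps bounded by [2 * w]. *)
have bound2 f g : (forall y, `|f y : H| <= 2 * w * `|y|) ->
    (forall y, `|g y : H| <= 2 * w * `|y|) -> `|f (g x)| <= 4 * w ^+ 2 * `|x|.
  move=> hf hg; apply: le_trans (hf _) _.
  have -> : 4 * w ^+ 2 * `|x| = 2 * w * (2 * w * `|x|) by ring.
  by apply: ler_wpM2l => //; rewrite mulr_ge0.
rewrite /anticomm_adjoint /=.
have [hx|->] := adjointP x; last first.
  rewrite (linear0 T) addr0.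
  by apply: bound2; [exact: normr_adjoint_le|exact: normr_operator_le].
have [ha|->] := adjointP (T x); last first.
  rewrite add0r.
  by apply: bound2; [exact: normr_operator_le|exact: normr_adjoint_le].
set b := adjoint T x in hx *; set z := _ + _.
pose p := T x + b; pose q := T x - b.
have b' v : '[b, v] = '[x, T v].
  by rewrite inner_conj -hx -inner_conj.
have hp : `|p| <= 2 * w * `|x|.
  apply: normr_le_of_inner => //.
  (* Pairing [p] with itself gives the symmetric form at [x] and [p]; likewise [q] gives the skew
     form. *)
  by rewrite {1}/p innerDl b'; exact: sym_bound.
have hq : `|q| <= 2 * w * `|x|.
  apply: normr_le_of_inner => //.
  by rewrite {1}/q innerDl innerNl b'; exact: skew_bound.
apply: normr_le_of_inner; first by rewrite !mulr_ge0 ?exprn_ge0.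
rewrite -(ler_pM2l (x := 2)) // -[X in X * `|_|](ger0_norm (x := 2)) // -normrM.
have -> : 2 * '[z, z] =
    ('[T p, z] + '[p, T z]) - ('[T q, z] - '[q, T z]).
  rewrite {1}/z innerDl [in LHS]inner_conj -ha -inner_conj /p /q.
  rewrite (linearB T) (linearD T (T x) b) !(innerDl, innerNl); ring.
apply: le_trans (ler_normB _ _) _.
apply: le_trans (lerD (sym_bound _ _) (skew_bound _ _)) _.
rewrite -mulrDl -mulrDr mulrA; apply: ler_wpM2r => //.
have -> : 2 * (4 * w ^+ 2 * `|x|) = 2 * w * (2 * w * `|x| + 2 * w * `|x|).
  by ring.
by apply: ler_wpM2l; [rewrite mulr_ge0|exact: lerD].
Qed.

End NumericalRadiusBound.

(** Nonnegativity of [x] covers the empty set, whose [sup] is 0 by convention. *)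
Lemma ge0_ge_sup (R : realType) (A : set R) (x : R) :
  0 <= x -> ubound A x -> sup A <= x.
Proof.
move=> x0 ubx; have [->|/set0P A0] := eqVneq A set0; first by rewrite sup0.
exact: ge_sup.
Qed.

Lemma sup_ge0 (R : realType) (A : set R) :
  (forall x, A x -> 0 <= x) -> 0 <= sup A.
Proof.
move=> A0; have [hA|/sup_out ->//] := pselect (has_sup A).
have [[x Ax] ubA] := hA; apply: (le_trans (A0 _ Ax)).
exact: ub_le_sup.
Qed.

(** * Passage to the suprema in [R] *)

Section NumericalRadius.
Local Open Scope complex_scope.
Variables (R : realType) (H : hilbertType R) (T : {linear H -> H}).
Hypothesis bT : bounded_operator T.

Lemma rnorm_ge0 (V : normedZmodType R[i]) (x : V) : 0 <= rnorm x.
Proof. by rewrite -lecR rnormE; exact: normr_ge0. Qed.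

Lemma numerical_radius_ub (x : H) :
  rnorm x = 1 -> rnorm '[T x, x] <= numerical_radius T.
Proof.
move=> x1; apply: ub_le_sup; last by exists x.
(* By Cauchy-Schwarz, a bound [M] for the operator also bounds the quadratic form on unit
   vectors. *)
have [M hM] := bT; exists M => _ [y /= y1 <-].
rewrite -lecR rnormE; apply: le_trans (normr_inner_le _ _ _ _) _.
have := hM y; rewrite y1 mulr1 -lecR rnormE.
by rewrite -(rnormE y) y1 mulr1.
Qed.

Lemma numerical_radius_ge0 : 0 <= numerical_radius T.
Proof. by apply: sup_ge0 => _ [x _ <-]; exact: rnorm_ge0. Qed.

(** Normalizing [x] reduces this to unit vectors; it provides the hypothesis [hw] with the numerical
    radius as [w]. *)
Lemma normr_quad_form_le (x : H) :
  `|'[T x, x]| <= (numerical_radius T)%:C * `|x| ^+ 2.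
Proof.
have [->|x0] := eqVneq x 0.
  by rewrite (linear0 T) linear0l !normr0 expr0n mulr0.
have nx0 : `|x| != 0 by rewrite normr_eq0.
pose y := `|x|^-1 *: x.
have y1 : rnorm y = 1.
  by rewrite /rnorm normrZ normfV normr_id mulVf.
have := numerical_radius_ub y y1.
rewrite -lecR rnormE /y (linearZ_LR T) /= innerZl innerZr.
rewrite fmorphV /= (CrealP (normr_real _)) !normrM normfV normr_id.
by rewrite mulrA -invfM -expr2 ler_pdivrMl ?exprn_gt0 ?normr_gt0 // mulrC.
Qed.

Lemma opnorm_anticomm_adjoint_le :
  opnorm (anticomm_adjoint T) <= 4 * numerical_radius T ^+ 2.
Proof.
have w0 := numerical_radius_ge0.
apply: ge0_ge_sup; first by rewrite mulr_ge0 ?exprn_ge0.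
move=> _ [x /= x1 <-].
have w0' : 0 <= (numerical_radius T)%:C by rewrite lecR.
have := normr_anticomm_adjoint_le _ _ _ _ normr_quad_form_le w0' x.
rewrite -!rnormE -rmorphXn -(rmorph_nat (real_complex R)) -!rmorphM lecR /=.
move=> /le_trans; apply; rewrite -[leRHS]mulr1.
by apply: ler_wpM2l => //; rewrite mulr_ge0 ?exprn_ge0.
Qed.

End NumericalRadius.

Theorem theorem2p35 (R : realType) (H : hilbertType R) (T : {linear H -> H}) :
  bounded_operator T ->
  let H0 : set H := norm_attaining T in
  let T0 : H0 -> H := sigL H0 T in
  let N : R := opnorm (anticomm_adjoint T) in
  H0 <> [set 0] ->
  let S : R :=
    sup [set ab.1 / (ab.1 + ab.2) *
             sup [set rnorm '[T0 x, set_val x] ^+ 2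
                 | x in [set x : H0 | rnorm (set_val x) = 1]]
             + ab.2 / (4 * (ab.1 + ab.2)) * N
        | ab in [set ab : R * R | [/\ 0 <= ab.1, 0 <= ab.2 & ab <> (0, 0)]]] in
  numerical_radius T ^+ 2 >= S /\ S >= 1 / 4 * N.
Proof.
move=> bT H0 T0 N _ S.
have w0 := numerical_radius_ge0 _ _ T.
have w20 : 0 <= numerical_radius T ^+ 2 by rewrite exprn_ge0.
have hN : N <= 4 * numerical_radius T ^+ 2 by exact: opnorm_anticomm_adjoint_le.
rewrite /S; set s := sup [set rnorm '[T0 x, set_val x] ^+ 2 | x in _].
have hs : s <= numerical_radius T ^+ 2.
  apply: ge0_ge_sup => // _ [x /= x1 <-].
  rewrite ler_sqr ?nnegrE ?rnorm_ge0 //.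
  exact: numerical_radius_ub.
set A := image _ _.
have ubA : ubound A (numerical_radius T ^+ 2).
  move=> _ [[a b] /= [a0 b0 ab0] <-].
  have ab : 0 < a + b.
    rewrite lt_neqAle addr_ge0 // andbT eq_sym paddr_eq0 //.
    by apply/negP => /andP[/eqP a0' /eqP b0']; apply: ab0; rewrite a0' b0'.
  (* A weighted mean of [s] and [N / 4], each at most the squared numerical radius. *)
  have -> : a / (a + b) * s + b / (4 * (a + b)) * N =
      (a * s + b * (N / 4)) / (a + b) by field; rewrite gt_eqF.
  rewrite ler_pdivrMr // [leRHS]mulrC mulrDl.
  by apply: lerD; apply: ler_wpM2l => //; rewrite ler_pdivrMr // mulrC.
split; first exact: ge0_ge_sup.
apply: ub_le_sup; first by exists (numerical_radius T ^+ 2).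
(* These weights select exactly [N / 4]. *)
exists (0, 1) => /=.
  by split => //; case => /eqP; rewrite oner_eq0.
by field.
Qed.
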